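(* Let $n$ be a positive integer and let $S=S_1\cup S_2\subseteq T_{8n}\setminus\{e\}$, where $S_1=\{b^2,a^nb^2\}$ and $S_2=\langle a\rangle b\cup\langle a\rangle b^3$ (so that $S=S^{-1}$). Then the normal Cayley graph $\mathrm{Cay}(T_{8n},S)$ is a connected integral graph, whose spectrum is $$\mathrm{Spec}(\mathrm{Cay}(T_{8n},S))=\left\{[-4n+2],\,[4n+2],\,[2]^{2n-2},\,[-2]^{2n},\,[0]^{4n}\right\}.$$
   Context: $T_{8n}=\langle a,b\mid a^{2n}=b^8=e,\ a^n=b^4,\ b^{-1}ab=a^{-1}\rangle$ is a group of order $8n$ with elements $a^rb^s$, $0\le r\le 2n-1$, $0\le s\le 3$. For a finite group $G$ with identity $e$ and a nonempty $S\subseteq G\setminus\{e\}$ with $S=S^{-1}$, $\mathrm{Cay}(G,S)$ is the graph with vertex set $G$ in which $x,y$ are adjacent iff $xy^{-1}\in S$; it is called normal if $S$ is a union of conjugacy classes of $G$. A graph is integral if all eigenvalues of its adjacency matrix are integers. $\mathrm{Spec}$ is the multiset of adjacency eigenvalues; $[\lambda]^m$ means $m$ copies of $\lambda$ ($m$ omitted if $m=1$), the display being read as a multiset, so that copies are added if two listed values coincide for small $n$. *)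

(* Defs.v *)
From HB Require Import structures.
From mathcomp Require Import all_boot all_order all_algebra all_fingroup.
From mathcomp Require Import all_field.

Set Implicit Arguments.
Unset Strict Implicit.
Unset Printing Implicit Defensive.

Import Order.TTheory GRing.Theory Num.Theory.

Local Open Scope group_scope.

(* The presentation determines gT up to isomorphism; the remaining conjuncts  *)
(* say that the named elements a, b of gT are generators satisfying its       *)
(* relations, i.e., the images of x, y under some such isomorphism.           *)
Definition is_T8n (n : nat) (gT : finGroupType) (a b : gT) : Prop :=
  [set: gT] \isog Grp (x : y : x ^+ (2 * n), y ^+ 8, x ^+ n = y ^+ 4,
                               y^-1 * x * y = x^-1)
  /\ <<[set a; b]>> = [set: gT]
  /\ [/\ a ^+ (2 * n) = 1, b ^+ 8 = 1, a ^+ n = b ^+ 4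
       & b^-1 * a * b = a^-1].

Definition connection_set (gT : finGroupType) (S : {set gT}) : bool :=
  [&& S != set0, S \subset [set: gT] :\ 1 & S^-1 == S].

Definition cay (gT : finGroupType) (S : {set gT}) : rel gT :=
  [rel x y | x * y^-1 \in S].

Definition normal_cay (gT : finGroupType) (S : {set gT}) : Prop :=
  exists2 C : {set {set gT}}, C \subset classes [set: gT] & S = cover C.

Definition T8n_S1 (n : nat) (gT : finGroupType) (a b : gT) : {set gT} :=
  [set b ^+ 2; a ^+ n * b ^+ 2].

Definition T8n_S2 (gT : finGroupType) (a b : gT) : {set gT} :=
  <[a]> :* b :|: <[a]> :* (b ^+ 3).

Local Close Scope group_scope.
Local Open Scope ring_scope.

Definition connected_graph (V : finType) (e : rel V) : Prop :=
  forall x y : V, connect e x y.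

Definition adjmx (V : finType) (e : rel V) : 'M[algC]_#|V| :=
  \matrix_(i, j) (e (enum_val i) (enum_val j))%:R.

Definition integral_graph (V : finType) (e : rel V) : Prop :=
  forall x : algC, eigenvalue (adjmx e) x -> x \in Num.int.

(* The roots of the characteristic polynomial, repeated according to          *)
(* multiplicity, in an unspecified order: to be compared up to perm_eq.       *)
Definition graph_spec (V : finType) (e : rel V) : seq algC :=
  sval (closed_field_poly_normal (char_poly (adjmx e))).

(* Main.v *)
Require Import Defs.
From HB Require Import structures.
From mathcomp Require Import all_boot all_order all_algebra all_fingroup.
From mathcomp Require Import all_solvable all_field.
From mathcomp Require Import zify ring.

Set Implicit Arguments.
Unset Strict Implicit.
Unset Printing Implicit Defensive.

Import Order.TTheory GRing.Theory Num.Theory.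
Local Open Scope ring_scope.

(* In T8n the subgroup H = <a> is normal of order 2n and b has order 4 modulo *)
(* H; that the order is not smaller is seen on a permutation model of the     *)
(* normal forms a^r b^s. With x and E the matrices of b and of the sum of H   *)
(* in the regular representation, the adjacency matrix is M1 + M2 where       *)
(* M1 = x^2 + x^6 and M2 = E (x + x^3), and M1 M2 = 2 M2, whence              *)
(*   (X - M1)(X - 2 - M2) = (X - 2)(X - M1 - M2).                             *)
(* As M1^3 = 4 M1 and M2^3 = (4n)^2 M2, the characteristic polynomials of M1  *)
(* and M2 are determined by the traces of these matrices and their squares.   *)

(** By [adjmx_cay] the adjacency matrix is the sum of [S] in the left regular representation, where
    the trace only sees the coefficient of the identity. So every trace needed below reduces to
    deciding which products of generators are trivial, which [T8n_order] settles.

    Here M1 has eigenvalues 2 and -2, each 2n times, and 0, 4n times; M2 has 4n and -4n, once each,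
    and 0 otherwise ([char_poly_cubic]). Since M1 M2 = 2 M2 ([M12]), the image of M2 is a plane
    inside the 2-eigenspace of M1. Adding M2 therefore replaces two of the 2n eigenvalues 2 by 2 +
    4n and 2 - 4n; [char_poly_addmx] expresses this by determinants. Integrality is read off the
    resulting factorization.

    The graph is connected because [b] and [a * b] lie in S, and normal because both generators
    normalize S. *)

Lemma char_poly_conj (F : fieldType) n (P A : 'M[F]_n) :
  P \in unitmx -> char_poly (P *m A *m invmx P) = char_poly A.
Proof.
move=> Pu; rewrite /char_poly /char_poly_mx.
have PP : map_mx polyC P *m map_mx polyC (invmx P) = 1%:M.
  by rewrite -map_mxM mulmxV // map_mx1.
have -> : 'X%:M - map_mx polyC (P *m A *m invmx P) =
    map_mx polyC P *m ('X%:M - map_mx polyC A) *m map_mx polyC (invmx P).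
  rewrite mulmxBr mulmxBl -!map_mxM /= mul_mx_scalar -scalemxAl.
  by rewrite [_ *m map_mx _ (invmx P)]PP scalemx1.
by rewrite !det_mulmx mulrAC -det_mulmx PP det1 mul1r.
Qed.

(* The hypotheses force [M] to be diagonalizable with eigenvalues [0], [c],   *)
(* [-c]; the traces of [M] and [M ^ 2] then determine the multiplicities.     *)
Lemma char_poly_cubic (F : numFieldType) n (M : 'M[F]_n) (c d : F) k :
    c != 0 -> M *m M *m M = c ^+ 2 *: M ->
    \tr M = 0 -> \tr (M *m M) = c ^+ 2 * (2 * k)%:R ->
  [/\ (2 * k <= n)%N & char_poly (M + d%:M) =
    ('X - (d + c)%:P) ^+ k * ('X - (d - c)%:P) ^+ k
      * ('X - d%:P) ^+ (n - 2 * k)].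
Proof.
move=> c0 M3 trM trM2.
have two0 : (2 : F) != 0 by rewrite pnatr_eq0.
have cNc : (c == - c) = false.
  by apply/negbTE; rewrite -subr_eq0 opprK -mulr2n -mulr_natl mulf_neq0.
have [P Pu [D defM]] : exists2 P, P \in unitmx &
    exists D, P *m M *m invmx P = diag_mx D.
  (* The minimal polynomial criterion is applied in positive size only; the empty matrix is already
     diagonal. *)
  case: n M M3 {trM trM2} => [|n] M M3.
    by exists 1%:M; [exact: unitmx1 | exists 0; rewrite !thinmx0].
  have /diagonalizableP [P Pu /diagonalizable_forPex[D /(simmxRL Pu) defD]] :
      exists2 rs, uniq rs & mxminpoly M %| \prod_(x <- rs) ('X - x%:P).
    exists [:: 0; c; - c].
      by rewrite /= !inE negb_or !(eq_sym 0) oppr_eq0 c0 cNc.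
    apply: mxminpoly_min; rewrite !big_cons big_nil mulr1 subr0 polyCN opprK.
    have -> : 'X * (('X - c%:P) * ('X + c%:P)) = 'X ^+ 3 - (c ^+ 2)%:P * 'X.
      by rewrite -subr_sqr polyC_exp mulrBr [_ * (_ ^+ 2)]mulrC -exprSr [_ * 'X]mulrC.
    rewrite rmorphB [X in _ - X]rmorphM rmorphXn /=.
    rewrite horner_mx_X horner_mx_C.
    by rewrite -mulmxE mul_scalar_mx -M3 exprSr expr2 -!mulmxE subrr.
  by exists P => //; exists D.
have conjM X Y : (P *m X *m invmx P) *m (P *m Y *m invmx P)
    = P *m (X *m Y) *m invmx P.
  by rewrite !mulmxA mulmxKV.
have trP X : \tr (P *m X *m invmx P) = \tr X.
  by rewrite mxtrace_mulC mulmxA mulVmx // mul1mx.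
have D3 i : D 0 i * D 0 i * D 0 i = c ^+ 2 * D 0 i.
  have : diag_mx D *m diag_mx D *m diag_mx D = c ^+ 2 *: diag_mx D.
    by rewrite -defM !conjM M3 -scalemxAr -scalemxAl.
  rewrite !mulmx_diag => /matrixP/(_ i i).
  by rewrite !mxE eqxx !mulr1n.
have Dcase i : [|| D 0 i == c, D 0 i == - c | D 0 i == 0].
  have : D 0 i * ((D 0 i - c) * (D 0 i + c)) = 0.
    by rewrite -subr_sqr mulrBr mulrA D3 mulrC expr2 subrr.
  move/eqP; rewrite !mulf_eq0 subr_eq0 addr_eq0.
  by case/or3P=> ->; rewrite ?orbT.
pose kp := #|[pred i | D 0 i == c]|; pose km := #|[pred i | D 0 i == - c]|.
pose k0 := #|[pred i | D 0 i == 0]|.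
(* An arbitrary commutative monoid, because the same splitting serves for the size count, the two
   traces and the characteristic polynomial. *)
have split3 (T : Type) (idx : T) (op : Monoid.com_law idx) (f : F -> T) :
    \big[op/idx]_i f (D 0 i) =
    op (op (\big[op/idx]_(i in [pred i | D 0 i == c]) f c)
           (\big[op/idx]_(i in [pred i | D 0 i == - c]) f (- c)))
       (\big[op/idx]_(i in [pred i | D 0 i == 0]) f 0).
  rewrite (bigID [pred i | D 0 i == c]) /= -Monoid.mulmA; congr (op _ _).
    by apply: eq_bigr => i /eqP ->.
  rewrite (bigID [pred i | D 0 i == - c]) /=; congr (op _ _).
    apply: eq_big => [i | i /andP[_ /eqP ->]] //=.
    by rewrite !inE; case: (D 0 i =P - c) => [->|]; rewrite ?andbF // eq_sym cNc.
  apply: eq_big => [i | i ].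
    rewrite !inE; have := Dcase i.
    case: eqP => [->|_] /=; first by rewrite (negbTE c0).
    by case: eqP => [->|_] /=; rewrite ?oppr_eq0 ?(negbTE c0) // => ->.
  by have := Dcase i; case/or3P=> /eqP ->; rewrite ?eqxx ?andbF.
have nE : (kp + km + k0)%N = n.
  have := split3 nat 0%N addn (fun=> 1%N).
  by rewrite !sum1_card card_ord => <-.
have kpm : kp = km.
  have : \tr (diag_mx D) = 0 by rewrite -defM trP.
  rewrite mxtrace_diag (split3 _ _ _ id) /= !sumr_const mul0rn addr0 mulNrn.
  move/eqP; rewrite subr_eq0 -!(mulr_natl c) => /eqP/(mulIf c0)/eqP.
  by rewrite eqr_nat => /eqP.
have kk : kp = k.
  have : \tr (diag_mx D *m diag_mx D) = c ^+ 2 * (2 * k)%:R.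
    by rewrite -defM conjM trP.
  rewrite mulmx_diag mxtrace_diag.
  under eq_bigr do rewrite mxE.
  rewrite (split3 _ _ _ (fun x => x * x)) /= !sumr_const mul0r mul0rn addr0.
  rewrite -/kp -/km -kpm mulrNN -mulrnDr addnn -mul2n -expr2 -[LHS]mulr_natr.
  move=> /(mulfI (expf_neq0 2 c0)) /eqP; rewrite eqr_nat eqn_pmul2l //.
  by move/eqP.
have knE : (2 * k + k0 = n)%N by rewrite mul2n -addnn -{2}kk kpm -{1}kk.
split; first by rewrite -knE leq_addr.
rewrite -(char_poly_conj _ Pu) mulmxDr mulmxDl defM mul_mx_scalar -scalemxAl.
rewrite mulmxV // scalemx1 char_poly_trig; last first.
  apply/is_trig_mxP => i j lt_ij; rewrite !mxE -val_eqE ltn_eqF //.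
  by rewrite !mulr0n addr0.
under eq_bigr do rewrite !mxE eqxx !mulr1n addrC.
rewrite (split3 _ _ _ (fun x => 'X - (d + x)%:P)) /= !prodr_const.
by rewrite -/kp -/km -/k0 -kpm kk addr0 -[in RHS]knE addKn.
Qed.

(** * A permutation model of order at least 8n *)

Section PermModel.

Local Open Scope group_scope.

(* The regular right action of [T8n] on its normal forms: the triple          *)
(* [(r, (u, v))] stands for [a ^+ r * b ^+ (2 * u + v)].                      *)
Variables (n : nat) (n_gt0 : (0 < n)%N).
Local Notation X := ('Z_(2 * n) * (bool * bool))%type.

(** Moving [a] leftwards past each [b] inverts it, so the parity [v] of the exponent of [b] gives
    the sign. *)
Definition mul_a (x : X) : X :=
  ((if x.2.2 then x.1 - 1 else x.1 + 1)%R, x.2).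

(** The exponent of [b] is counted modulo 4; its carry is b^4 = a^n, hence the shift by [n]. *)
Definition mul_b (x : X) : X :=
  let: (r, (u, v)) := x in
  if v then ((if u then r + n%:R else r)%R, (~~ u, false)) else (r, (u, true)).

Lemma mul_a_inj : injective mul_a.
Proof.
move=> [r [u v]] [r' [u' v']] [+ -> vE]; rewrite /= vE.
by case: v' {vE} => e; congr (_, _); apply: addIr e.
Qed.

Lemma mul_b_inj : injective mul_b.
Proof.
move=> [r [[] []]] [r' [[] []]] //= e; congr (_, _);
  by have /= := congr1 fst e => // /addIr.
Qed.

Definition perm_a := perm mul_a_inj.
Definition perm_b := perm mul_b_inj.

Lemma perm_aX k (x : X) :
  (perm_a ^+ k) x = ((if x.2.2 then x.1 - k%:R else x.1 + k%:R)%R, x.2).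
Proof.
case: x => r [u v]; elim: k => [|k IH].
  by rewrite perm1 /= subr0 addr0; case: v.
rewrite expgSr permM IH permE /mul_a /=; case: v {IH} => /=.
  by rewrite -addrA -opprD -natr1.
by rewrite -addrA -natr1.
Qed.

Lemma perm_b4 (x : X) : (perm_b ^+ 4) x = ((x.1 + n%:R)%R, x.2).
Proof.
by case: x => r [[] []]; rewrite !expgS !permM perm1 !permE /mul_b /=.
Qed.

Lemma double_gt1 : (1 < 2 * n)%N.
Proof. by rewrite (@leq_pmul2l 2 1). Qed.

Lemma natr2n : ((2 * n)%:R = 0 :> 'Z_(2 * n))%R.
Proof. by rewrite pchar_Zp // double_gt1. Qed.

Lemma perm_a2n : perm_a ^+ (2 * n) = 1.
Proof.
apply/permP => -[r [u v]]; rewrite perm_aX perm1 natr2n /=.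
by rewrite subr0 addr0; case: v.
Qed.

Lemma perm_an : perm_a ^+ n = perm_b ^+ 4.
Proof.
apply/permP => -[r [u v]]; rewrite perm_aX perm_b4 /=; case: v => //.
(* Modulo 2n one has -n = n, so the sign does not matter. *)
congr (_, _); apply: (congr1 (fun t => r + t)%R); apply/eqP.
by rewrite eq_sym -subr_eq0 opprK -natrD addnn -mul2n natr2n.
Qed.

Lemma perm_b8 : perm_b ^+ 8 = 1.
Proof. by rewrite (expgM _ 4 2) -perm_an -expgM [(n * 2)%N]mulnC perm_a2n. Qed.

Lemma perm_conj : perm_b^-1 * perm_a * perm_b = perm_a^-1.
Proof.
(* The relation is rewritten without inverses so that it can be checked pointwise. *)
suff aba : perm_a * (perm_b * perm_a) = perm_b.
  by apply: (mulIg perm_a); rewrite mulVg -!mulgA aba mulVg.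
apply/permP => -[r [u v]]; rewrite !permM !permE /mul_a /mul_b /=.
case: v => /=; last by rewrite addrK.
by congr (_, _); case: u; rewrite ?subrK // addrAC subrK.
Qed.

(** The word a^r b^s sends the base point, the normal form of the identity, to the normal form of
    a^r b^s, so the 8n words act differently. *)
Lemma card_perm_model : (8 * n <= #|<<[set perm_a; perm_b]>>|)%N.
Proof.
pose nf (x : X) := perm_a ^+ x.1 * perm_b ^+ (2 * x.2.1 + x.2.2).
have nf_inj : injective nf.
  suff nfE x : nf x (0%R, (false, false)) = x.
    by move=> x y /(congr1 (fun p : {perm X} => p (0%R, (false, false)))); rewrite !nfE.
  rewrite /nf permM perm_aX /= add0r natr_Zp; case: x => r [u v] /=.
  by case: u v => [] []; rewrite ?expgS ?permM perm1 ?permE.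
have <- : #|{: X}| = (8 * n)%N.
  rewrite !card_prod card_bool card_ord Zp_cast.
    by rewrite mulnC mulnA.
  exact: double_gt1.
rewrite -(card_codom nf_inj); apply/subset_leq_card/subsetP => _ /codomP[x ->].
by rewrite groupM ?groupX ?mem_gen ?inE ?eqxx ?orbT.
Qed.

End PermModel.

(** * The order of T8n and the cosets of [<[a]>] *)

Section T8nStructure.

Local Open Scope group_scope.

Variables (n : nat) (gT : finGroupType) (a b : gT).
Hypotheses (n_gt0 : (0 < n)%N) (hT : is_T8n n a b).

(** By the universal property of the presentation, the permutation model is a quotient of the
    group. *)
Lemma leq_card_T8n : (8 * n <= #|gT|)%N.
Proof.
have [isoT _] := hT.
pose K := <<[set perm_a n; perm_b n]>>%G.
have homK : K \homg [set: gT].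
  rewrite isoT; apply/existsP; exists (perm_a n, perm_b n).
  rewrite /= !xpair_eqE /= joing_idl joing_idr eqxx.
  by rewrite perm_a2n ?perm_b8 ?perm_an ?perm_conj ?eqxx.
rewrite -cardsT (leq_trans (card_perm_model n_gt0)) //.
by rewrite dvdn_leq ?cardG_gt0 // (card_homg homK).
Qed.

Lemma T8n_conj : a ^ b = a^-1.
Proof. by have [_ [_ [_ _ _ <-]]] := hT; rewrite conjgE mulgA. Qed.

Lemma T8n_b8 : b ^+ 8 = 1.
Proof. by have [_ [_ []]] := hT. Qed.

Lemma T8n_an : a ^+ n = b ^+ 4.
Proof. by have [_ [_ []]] := hT. Qed.

Lemma T8n_gen : <<[set a; b]>> = [set: gT].
Proof. by have [_ []] := hT. Qed.

Lemma T8n_b4_cycle : b ^+ 4 \in <[a]>.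
Proof. by rewrite -T8n_an mem_cycle. Qed.

Lemma T8n_norm_b : b \in 'N(<[a]>).
Proof.
by rewrite -cycle_subG norms_cycle T8n_conj groupV cycle_id.
Qed.

Lemma T8n_commute_b2 : commute a (b ^+ 2).
Proof. 
apply/commgP/conjg_fixP.
by rewrite expgS expg1 conjgM T8n_conj conjVg T8n_conj invgK. Qed.

Lemma T8n_cycle_join : <[a]> <*> <[b]> = [set: gT].
Proof. by rewrite joing_idl joing_idr; exact: T8n_gen. Qed.

(** The relations bound the two orders by 2n and 4, and their product is the order of the group; the
    lower bound 8n forces equality in both. *)
Lemma T8n_order :
  [/\ #|gT| = (8 * n)%N, #[a] = (2 * n)%N & #[coset <[a]> b] = 4%N].
Proof.
have [_ [_ [a2n _ _ _]]] := hT.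
have nab := T8n_norm_b.
have nHT : <[a]> <| [set: gT].
  rewrite /normal subsetT -T8n_cycle_join join_subG normG /=.
  by rewrite cycle_subG.
have le_a : (#[a] <= 2 * n)%N by rewrite dvdn_leq ?muln_gt0 // order_dvdn a2n.
have le_b : (#[coset <[a]> b] <= 4)%N.
  by rewrite dvdn_leq // order_dvdn -morphX //= coset_id // T8n_b4_cycle.
have quoT : [set: gT] / <[a]> = <[coset <[a]> b]>.
  by rewrite -T8n_cycle_join quotientYidl ?cycle_subG // quotient_cycle.
have cardT : #|gT| = (#[a] * #[coset <[a]> b])%N.
  rewrite -cardsT -(Lagrange (normal_sub nHT)) -card_quotient ?normal_norm //.
  by rewrite quoT.
have := leq_card_T8n; rewrite cardT => le_8n.
have oE : (#[a] * #[coset <[a]> b] = 8 * n)%N.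
  apply/eqP; rewrite eqn_leq le_8n andbT.
  by rewrite (leq_trans (leq_mul le_a le_b)) // mulnAC.
have o_a : #[a] = (2 * n)%N.
  apply/eqP; rewrite eqn_leq le_a -(@leq_pmul2r 4) //=.
  by rewrite mulnAC -[(2 * 4)%N]/8%N -oE leq_pmul2l ?order_gt0.
split=> //.
apply/eqP; rewrite -(@eqn_pmul2l #[a]) ?order_gt0 // oE o_a.
by rewrite mulnAC.
Qed.

Lemma T8n_bX_cycle k : (b ^+ k \in <[a]>) = (4 %| k)%N.
Proof.
have [_ _ <-] := T8n_order; have nab := T8n_norm_b.
rewrite order_dvdn -morphX //=; apply/idP/eqP => [/coset_id -> //|].
by move/coset_idr; apply; rewrite groupX.
Qed.

Lemma T8n_b4_neq1 : b ^+ 4 != 1.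
Proof.
have [_ o_a _] := T8n_order.
rewrite -T8n_an -order_dvdn o_a; apply/negP => /(dvdn_leq n_gt0).
by rewrite leqNgt -{1}[n]mul1n ltn_pmul2r.
Qed.

End T8nStructure.

(** * The left regular representation *)

Section RegularMatrices.

Variable gT : finGroupType.
Local Notation N := #|gT|.

Definition reg_mx (g : gT) : 'M[algC]_N :=
  \matrix_(i, j) (enum_val i == g * enum_val j)%g%:R.

Definition reg_sum (A : {set gT}) : 'M[algC]_N := \sum_(g in A) reg_mx g.

Lemma reg_mx1 : reg_mx 1%g = 1.
Proof.
by apply/matrixP => i j; rewrite !mxE mul1g (inj_eq enum_val_inj).
Qed.

Lemma reg_mxM g h : reg_mx (g * h)%g = reg_mx g * reg_mx h.
Proof.
apply/matrixP => i j; rewrite !mxE (bigD1 (enum_rank (h * enum_val j)%g)) //=.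
rewrite big1 ?addr0 => [|k ne_k]; rewrite !mxE ?enum_rankK ?eqxx ?mulr1 ?mulgA //.
have -> : (enum_val k == h * enum_val j)%g = false; last by rewrite mulr0.
by apply: contraNF ne_k => /eqP <-; rewrite enum_valK.
Qed.

Lemma reg_mxX g k : reg_mx (g ^+ k)%g = reg_mx g ^+ k.
Proof. by elim: k => [|k IH]; rewrite ?reg_mx1 // expgS reg_mxM IH exprS. Qed.

(** A nontrivial translation has no fixed point. *)
Lemma mxtrace_reg g : \tr (reg_mx g) = if g == 1%g then N%:R else 0.
Proof.
have trE (i : 'I_N) : reg_mx g i i = (g == 1%g)%:R.
  by rewrite mxE -{1}(mul1g (enum_val i)) (inj_eq (mulIg _)) eq_sym.
rewrite /mxtrace (eq_bigr _ (fun i _ => trE i)) sumr_const card_ord.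
by case: eqP => // _; rewrite mul0rn.
Qed.

Lemma mxtrace_reg_sum A : \tr (reg_sum A) = if 1%g \in A then N%:R else 0.
Proof.
rewrite /reg_sum raddf_sum /= (eq_bigr _ (fun g _ => mxtrace_reg g)).
rewrite -big_mkcondr /=; case: ifP => A1; last first.
  by apply: big1 => g /andP[gA /eqP g1]; rewrite -g1 gA in A1.
rewrite (big_pred1 1%g) // => g /=.
by have [->|_] := eqVneq g 1%g; rewrite ?A1 ?andbF.
Qed.

Lemma adjmx_cay (S : {set gT}) : adjmx (cay S) = reg_sum S.
Proof.
apply/matrixP => i j; rewrite summxE !mxE /cay /=.
set x := enum_val i; set y := enum_val j.
rewrite (eq_bigr (fun g => (g == x * y^-1)%g%:R)) => [|g _]; last first.
  by rewrite mxE -/x -/y; congr _%:R; rewrite -(inj_eq (mulIg y^-1%g)) mulgK eq_sym.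
case: (boolP (_ \in S)) => [Sxy | nSxy].
  by rewrite (bigD1 _ Sxy) /= eqxx big1 ?addr0 // => g /andP[_ /negbTE ->].
rewrite big1 // => g Sg; case: eqP => // gE.
by rewrite -gE Sg in nSxy.
Qed.

Lemma reg_sumU (A B : {set gT}) : [disjoint A & B] ->
  reg_sum (A :|: B) = reg_sum A + reg_sum B.
Proof.
move=> dAB; rewrite /reg_sum -bigU //=.
by apply: eq_bigl => g; rewrite !inE.
Qed.

Lemma reg_sum_rcoset (A : {set gT}) g : reg_sum (A :* g)%g = reg_sum A * reg_mx g.
Proof.
rewrite /reg_sum mulr_suml -rcosetE big_imset /=; last by move=> x y _ _ /mulIg.
by apply: eq_bigr => x _; rewrite reg_mxM.
Qed.

Lemma reg_sum_lcoset (A : {set gT}) g : reg_sum (g *: A)%g = reg_mx g * reg_sum A.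
Proof.
rewrite /reg_sum mulr_sumr -lcosetE big_imset /=; last by move=> x y _ _ /mulgI.
by apply: eq_bigr => x _; rewrite reg_mxM.
Qed.

Lemma reg_sum_norm (H : {group gT}) g :
  g \in 'N(H)%g -> GRing.comm (reg_sum H) (reg_mx g).
Proof.
by move=> nHg; rewrite /GRing.comm -reg_sum_rcoset -reg_sum_lcoset norm_rlcoset.
Qed.

Lemma reg_sum_group (H : {group gT}) g :
  g \in H -> reg_sum H * reg_mx g = reg_sum H.
Proof. by move=> Hg; rewrite -reg_sum_rcoset rcoset_id. Qed.

Lemma reg_sum_sqr (H : {group gT}) : reg_sum H * reg_sum H = reg_sum H *+ #|H|.
Proof.
rewrite {2}/reg_sum mulr_sumr -sumr_const.
by apply: eq_bigr => g /reg_sum_group.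
Qed.

End RegularMatrices.

(** * Algebraic relations satisfied by M1 and M2 *)

Section CyclicRelations.

(* [M1] and [M2] are the contributions of [T8n_S1] and [T8n_S2] when [x] and  *)
(* [E] are the matrices of [b] and of the sum of [<[a]>], with [h = 2n].      *)
Variables (R : pzRingType) (E x : R) (h : nat).
Hypotheses (x8 : x ^+ 8 = 1) (Ex4 : E * x ^+ 4 = E).
Hypotheses (EE : E * E = E *+ h) (Ex : GRing.comm E x).
Let M1 := x ^+ 2 + x ^+ 6.
Let M2 := E * (x + x ^+ 3).

Let x_red k : x ^+ (8 + k) = x ^+ k.
Proof. by rewrite exprD x8 mul1r. Qed.

Let Ex_red k : E * x ^+ (4 + k) = E * x ^+ k.
Proof. by rewrite exprD mulrA Ex4. Qed.

Lemma M1_sqr : M1 * M1 = 2 + x ^+ 4 *+ 2.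
Proof.
rewrite /M1 mulrDl !mulrDr -!exprD (x_red 0) (x_red 4) expr0.
by rewrite [x ^+ 4 + 1]addrC addrACA.
Qed.

Lemma M1_cube : M1 * M1 * M1 = M1 *+ 4.
Proof.
have x4M1 : x ^+ 4 * M1 = M1.
  by rewrite /M1 mulrDr -!exprD (x_red 2) addrC.
by rewrite M1_sqr mulrDl mulr_natl mulrnAl x4M1 -mulrnDr.
Qed.

(** As [E] absorbs x^4, E M1 = 2 E x^2, and multiplication by x^2 exchanges E x and E x^3. *)
Lemma M12 : M1 * M2 = M2 *+ 2.
Proof.
have -> : M1 * M2 = E * M1 * (x + x ^+ 3).
  by rewrite /M2 mulrA; congr (_ * _); apply/commr_sym/commrD; apply: commrX.
rewrite /M1 [E * _]mulrDr (Ex_red 2) -mulr2n mulrnAl; congr (_ *+ 2).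
by rewrite -mulrA mulrDr -exprSr -exprD mulrDr (Ex_red 1) -mulrDr addrC.
Qed.

Lemma M2_sqr : M2 * M2 = (E + E * x ^+ 2) *+ (2 * h).
Proof.
have Ey : GRing.comm E (x + x ^+ 3) by apply: commrD => //; apply: commrX.
rewrite /M2 mulrA -[_ * E]mulrA -Ey mulrA EE -mulrA.
have -> : (x + x ^+ 3) * (x + x ^+ 3) = x ^+ 2 + x ^+ 6 + x ^+ 4 *+ 2.
  rewrite mulrDl !mulrDr -!exprS -exprSr -!exprD.
  by rewrite addrA -[_ + _ + x ^+ 4]addrA addrAC.
rewrite mulrnA mulrnAl; congr (_ *+ h).
by rewrite mulrDr mulrnAr mulrDr Ex4 (Ex_red 2) -mulr2n -mulrnDl addrC.
Qed.

(** Under [E], (x + x^3)^2 is 2 (1 + x^2) and (1 + x^2)(x + x^3) is 2 (x + x^3); the three factors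
    [E] contribute h^2. *)
Lemma M2_cube : M2 * M2 * M2 = M2 *+ (4 * h ^ 2).
Proof.
have Ey : GRing.comm E (x + x ^+ 3) by apply: commrD => //; apply: commrX.
rewrite M2_sqr /M2 mulrnAl mulrA.
have -> : (E + E * x ^+ 2) * E = (E + E * x ^+ 2) *+ h.
  rewrite mulrDl EE -mulrA -(commrX 2 Ex) mulrA EE.
  by rewrite mulrnAl mulrnDl.
have -> : (E + E * x ^+ 2) *+ h * (x + x ^+ 3) = E * (x + x ^+ 3) *+ (2 * h).
  rewrite mulrnAl mulrnA mulrDl -[E * _ * _]mulrA [x ^+ 2 * _]mulrDr -exprSr.
  by rewrite -exprD [E * (x ^+ 3 + _)]mulrDr (Ex_red 1) -mulrDr [x ^+ 3 + _]addrC -mulr2n.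
by rewrite -mulrnA; congr (_ *+ _); rewrite -mulnn; lia.
Qed.

End CyclicRelations.

(** * General facts on sums of matrices, Cayley graphs and spectra *)

Lemma char_poly_addmx (R : comNzRingType) n (A B : 'M[R]_n) (c : R) :
    A *m B = c *: B ->
  char_poly A * char_poly (B + c%:M) = ('X - c%:P) ^+ n * char_poly (A + B).
Proof.
move=> AB; rewrite /char_poly -det_mulmx -detZ /char_poly_mx; congr (\det _).
rewrite !map_mxD map_scalar_mx /=.
have ABX : map_mx polyC A *m map_mx polyC B = c%:P *: map_mx polyC B.
  by rewrite -map_mxM AB map_mxZ.
rewrite mulmxBl !mulmxBr !mulmxDr !mul_scalar_mx !mul_mx_scalar ABX.
apply/matrixP => i j; rewrite !mxE.
by case: (i == j); rewrite ?mulr1n ?mulr0n; ring.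
Qed.

(** The elements [g] for which every [y] is joined to [g * y] form a subgroup containing S; in a
    finite group closure under products is enough. *)
Lemma connected_cay (gT : finGroupType) (S : {set gT}) :
  <<S>>%g = [set: gT] -> connected_graph (cay S).
Proof.
move=> genS; pose K := [set g | [forall y, connect (cay S) (g * y)%g y]].
have gK : group_set K.
  apply/group_setP; split=> [|g h]; rewrite !inE.
    by apply/forallP => y; rewrite mul1g connect0.
  move=> /forallP Kg /forallP Kh; apply/forallP => y.
  by rewrite -mulgA (connect_trans (Kg _)).
have sSK : S \subset Group gK.
  apply/subsetP => g Sg; rewrite inE; apply/forallP => y.
  by apply: connect1; rewrite /cay /= mulgK.
move=> x y; have : (x * y^-1)%g \in K.
  by apply: (subsetP (_ : <<S>>%g \subset Group gK)); rewrite ?gen_subG ?genS ?inE.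
by rewrite inE => /forallP/(_ y); rewrite mulgKV.
Qed.

Lemma normal_cay_norm (gT : finGroupType) (S : {set gT}) :
  [set: gT] \subset 'N(S)%g -> normal_cay S.
Proof.
move=> nS; exists [set (z ^: [set: gT])%g | z in S].
  by apply/subsetP => _ /imsetP[z _ ->]; rewrite mem_classes ?inE.
apply/setP => z; apply/idP/bigcupP => [Sz | [_ /imsetP[y Sy ->]]].
  exists (z ^: [set: gT])%g; last exact: class_refl.
  by apply/imsetP; exists z.
by case/imsetP => g _ ->; rewrite memJ_norm // (subsetP nS) ?inE.
Qed.

Lemma prod_graph_spec (V : finType) (e : rel V) :
  \prod_(z <- graph_spec e) ('X - z%:P) = char_poly (adjmx e).
Proof.
rewrite /graph_spec; case: closed_field_poly_normal => r /= rE.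
by rewrite [RHS]rE (monicP (char_poly_monic _)) scale1r.
Qed.

(** * The Cayley graph of T8n *)

Section T8nCayley.

Variables (n : nat) (gT : finGroupType) (a b : gT).
Hypotheses (n_gt0 : (0 < n)%N) (hT : is_T8n n a b).
Let S := T8n_S1 n a b :|: T8n_S2 a b.
Local Notation H := <[a]>%g.

Lemma T8n_S1E : T8n_S1 n a b = [set b ^+ 2; b ^+ 6]%g.
Proof. by rewrite /T8n_S1 (T8n_an hT) -expgD. Qed.

Lemma T8n_bX_rcoset k j : ((b ^+ (k + j))%g \in (H :* (b ^+ j))%g) = (4 %| k)%N.
Proof. by rewrite mem_rcoset expgD mulgK (T8n_bX_cycle n_gt0 hT). Qed.

Lemma T8n_S2_b2 : (b ^+ 2)%g \notin T8n_S2 a b.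
Proof.
rewrite inE -{2}[b]expg1 (T8n_bX_rcoset 1 1).
(* Raising the exponent by 8 makes it at least 3; the difference 7 is not a multiple of 4. *)
have -> : (b ^+ 2 = b ^+ (7 + 3))%g by rewrite (expgD b 8 2) (T8n_b8 hT) mul1g.
by rewrite T8n_bX_rcoset.
Qed.

Lemma T8n_S2_b6 : (b ^+ 6)%g \notin T8n_S2 a b.
Proof. by rewrite inE -{2}[b]expg1 (T8n_bX_rcoset 5 1) (T8n_bX_rcoset 3 3). Qed.

Lemma T8n_S2_1 : 1%g \notin T8n_S2 a b.
Proof.
rewrite -(T8n_b8 hT) inE -{2}[b]expg1 (T8n_bX_rcoset 7 1).
by rewrite (T8n_bX_rcoset 5 3).
Qed.

Lemma T8n_S12_disjoint : [disjoint T8n_S1 n a b & T8n_S2 a b].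
Proof.
rewrite T8n_S1E disjoints_subset; apply/subsetP => z.
by rewrite in_setC => /set2P[] ->; rewrite ?T8n_S2_b2 ?T8n_S2_b6.
Qed.

Lemma T8n_rcoset_disjoint : [disjoint (H :* b)%g & (H :* b ^+ 3)%g].
Proof.
apply/pred0P => z /=; apply/negP => /andP[/rcosetP[h Hh ->]].
rewrite mem_rcoset -mulgA groupMl // -groupV invMg invgK.
rewrite (_ : (_ * _ = b ^+ 2)%g); first by rewrite (T8n_bX_cycle n_gt0 hT 2).
by rewrite (expgSr b 2) mulgK.
Qed.

Lemma T8n_b2_neq1 : (b ^+ 2 != 1)%g.
Proof.
by apply: contraNneq (T8n_b4_neq1 n_gt0 hT) => b2; rewrite (expgM b 2 2) b2 expg1n.
Qed.

Lemma T8n_b6_neq1 : (b ^+ 6 != 1)%g.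
Proof.
apply: contraNneq T8n_b2_neq1 => b6.
by rewrite -[(b ^+ 2)%g]mul1g -{1}b6 -expgD (T8n_b8 hT).
Qed.

Lemma T8n_b26 : (b ^+ 2 != b ^+ 6)%g.
Proof.
by rewrite (expgD b 2 4) -{1}[(b ^+ 2)%g]mulg1 (inj_eq (mulgI _)) eq_sym (T8n_b4_neq1 n_gt0 hT).
Qed.

(** Inversion exchanges b^2 with b^6, and, since b^4 lies in [H], the coset of b with that of
    b^3. *)
Lemma T8n_S_invg g : g \in S -> (g^-1)%g \in S.
Proof.
have nHb := T8n_norm_b hT; have Hb4 := T8n_b4_cycle hT.
rewrite /S T8n_S1E !inE -!orbA => /or4P[/eqP->|/eqP->|/rcosetP[h Hh ->]|/rcosetP[h Hh ->]].
- by rewrite -[(b ^+ 2)^-1%g]mulg1 -(T8n_b8 hT) (expgD b 2 6) mulKg eqxx orbT.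
- by rewrite -[(b ^+ 6)^-1%g]mulg1 -(T8n_b8 hT) (expgD b 6 2) mulKg eqxx.
- apply/or4P/Or44; rewrite mem_rcoset invMg.
  have -> : (b^-1 * h^-1 * (b ^+ 3)^-1 = h^-1 ^ b * (b ^+ 4)^-1)%g.
    by rewrite conjgE [(b ^+ 4)%g](expgSr b 3) [((b ^+ 3 * b)^-1)%g]invMg !mulgA mulgK.
  by rewrite groupM ?groupV // memJ_norm // groupV.
- apply/or4P/Or43; rewrite mem_rcoset invMg.
  have -> : ((b ^+ 3)^-1 * h^-1 * b^-1 = h^-1 ^ (b ^+ 3) * (b ^+ 4)^-1)%g.
    rewrite conjgE [(b ^+ 4)%g](expgS b 3); move: (b ^+ 3)%g => c.
    by rewrite invMg !mulgA mulgK.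
  by rewrite groupM ?groupV // memJ_norm ?groupX // groupV.
Qed.

Lemma T8n_connection_set : connection_set S.
Proof.
apply/and3P; split.
- by apply/set0Pn; exists (b ^+ 2)%g; rewrite /S T8n_S1E !inE eqxx.
- rewrite subsetD1 subsetT /= /S in_setU negb_or T8n_S2_1 T8n_S1E !inE.
  by rewrite !(eq_sym 1%g) (negbTE T8n_b2_neq1) (negbTE T8n_b6_neq1).
- rewrite eqEsubset; apply/andP; split; apply/subsetP => g.
    by rewrite mem_invg => /T8n_S_invg; rewrite invgK.
  by rewrite mem_invg => /T8n_S_invg.
Qed.

Lemma T8n_normal_cay : normal_cay S.
Proof.
apply: normal_cay_norm; rewrite -(T8n_gen hT) gen_subG.
have nHb := T8n_norm_b hT; have ab2 := T8n_commute_b2 hT.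
have normU (g : gT) (A B : {set gT}) :
    g \in 'N(A)%g -> g \in 'N(B)%g -> g \in 'N(A :|: B)%g.
  by rewrite -!sub1set; apply: normsU.
have norm_commute (x y : gT) : commute x y -> x \in 'N([set y])%g.
  by move=> /commute_sym/commgP/conjg_fixP yx; rewrite inE conjg_set1 yx.
have norm_rcoset_a x : x \in 'N(H)%g -> a \in 'N(H :* x)%g.
  move=> nHx; apply/normP; rewrite conjsgE (norm_rlcoset nHx) -mulgA.
  rewrite (rcoset_id (cycle_id a)) -(norm_rlcoset nHx) mulgA lcoset_id //.
  by rewrite groupV cycle_id.
have norm_rcoset_b k : b \in 'N(H :* b ^+ k)%g.
  by apply/normP; rewrite conjsMg (normP nHb) conjg_set1 conjXg conjgE mulKg.
have ab6 : commute a (b ^+ 6)%g by rewrite (expgM b 2 3); apply: commuteX.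
have bbX k : commute b (b ^+ k)%g by apply: commuteX.
rewrite subUset !sub1set /S T8n_S1E; apply/andP; split.
  by rewrite !normU ?norm_commute ?norm_rcoset_a ?groupX.
by rewrite !normU ?norm_commute ?norm_rcoset_b // -{2}[b]expg1 norm_rcoset_b.
Qed.

Lemma T8n_connected : connected_graph (cay S).
Proof.
apply: connected_cay; apply/eqP; rewrite -subTset -(T8n_gen hT) gen_subG.
have Sb : b \in <<S>>%g by rewrite mem_gen // !inE rcoset_refl !orbT.
have Sab : (a * b)%g \in <<S>>%g.
  by rewrite mem_gen // !inE mem_rcoset mulgK cycle_id !orbT.
by rewrite subUset !sub1set Sb andbT -(groupMr _ Sb).
Qed.

Lemma T8n_char_poly : char_poly (adjmx (cay S)) =
  \prod_(z <- [:: - (4 * n)%:R + 2; (4 * n + 2)%:R]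
     ++ nseq (2 * n - 2) 2 ++ nseq (2 * n) (- 2) ++ nseq (4 * n) 0)
    ('X - z%:P).
Proof.
have [cardT o_a _] := T8n_order n_gt0 hT.
set x := reg_mx b; set E := reg_sum H.
have x8 : x ^+ 8 = 1 by rewrite -reg_mxX (T8n_b8 hT) reg_mx1.
have Ex4 : E * x ^+ 4 = E.
  by rewrite -reg_mxX (reg_sum_group (T8n_b4_cycle hT)).
have EE : E * E = E *+ (2 * n) by rewrite reg_sum_sqr -o_a.
have Ex : GRing.comm E x := reg_sum_norm (T8n_norm_b hT).
pose M1 := x ^+ 2 + x ^+ 6; pose M2 := E * (x + x ^+ 3).
have -> : adjmx (cay S) = M1 + M2.
  rewrite adjmx_cay /S reg_sumU ?T8n_S12_disjoint // T8n_S1E.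
  rewrite {1}/reg_sum big_setU1 ?inE ?T8n_b26 //= big_set1 !reg_mxX -/x.
  rewrite reg_sumU ?T8n_rcoset_disjoint // !reg_sum_rcoset reg_mxX -/x -/E.
  by rewrite /M2 [E * (_ + _)]mulrDr.
have tr1 : \tr (1 : 'M[algC]_#|gT|) = (8 * n)%:R by rewrite mxtrace1 cardT.
have M12e : M1 *m M2 = 2 *: M2.
  by rewrite scaler_nat; exact: M12 Ex4 Ex.
(* The multiplicity k = 2n comes from tr(M1^2) = 2 * 8n = 2^2 * 2k. *)
have [||||_ cp1] := @char_poly_cubic _ _ M1 2 0 (2 * n).
- by rewrite pnatr_eq0.
- by rewrite !mulmxE (M1_cube x8) -natrX scaler_nat.
- rewrite mxtraceD -!reg_mxX !mxtrace_reg.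
  by rewrite (negbTE T8n_b2_neq1) (negbTE T8n_b6_neq1) addr0.
- rewrite [M1 *m M1](M1_sqr x8) mxtraceD !raddfMn /= tr1.
  rewrite -!reg_mxX !mxtrace_reg (negbTE (T8n_b4_neq1 n_gt0 hT)).
  by rewrite mul0rn addr0 -mulrnA -natrX -natrM; congr _%:R; lia.
(* Here tr(M2^2) = 4n * 8n = (4n)^2 * 2, so k = 1; the shift 2 is the scalar in M1 M2 = 2 M2. *)
have [||||_ cp2] := @char_poly_cubic _ _ M2 (4 * n)%:R 2 1.
- by rewrite pnatr_eq0 muln_eq0 /= -lt0n.
- rewrite [_ *m M2](M2_cube Ex4 EE Ex) -natrX scaler_nat; congr (_ *+ _).
  by lia.
- rewrite /M2 mulrDr mxtraceD -reg_mxX -!reg_sum_rcoset !mxtrace_reg_sum.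
  have := T8n_S2_1; rewrite inE negb_or => /andP[/negbTE-> /negbTE->].
  by rewrite addr0.
- rewrite [_ *m M2](M2_sqr Ex4 EE Ex) raddfMn /= mxtraceD -reg_mxX -reg_sum_rcoset.
  rewrite !mxtrace_reg_sum group1 mem_rcoset mul1g groupV (T8n_bX_cycle n_gt0 hT) // cardT.
  by rewrite addr0 -mulrnA -natrX -natrM; congr _%:R; lia.
have two_neq0 : 'X - 2%:P != 0 :> {poly algC} by rewrite polyXsubC_eq0.
apply: (mulfI (expf_neq0 #|gT| two_neq0)).
rewrite raddf0 addr0 in cp1.
rewrite -(char_poly_addmx M12e) cp1 cp2 cardT.
rewrite big_cat /= !big_cons big_nil mulr1 !big_cat /= !big_nseq !iter_mulr_1.
rewrite add0r sub0r !expr1 -[2 + _]natrD [(2 + 4 * n)%N]addnC [2 - _]addrC.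
have -> : (8 * n - 2 * (2 * n) = 4 * n)%N by lia.
(* Both truncated subtractions are exact because n is positive. *)
have eN : ('X - 2%:P) ^+ (8 * n) * ('X - 2%:P) ^+ (2 * n - 2) =
    ('X - 2%:P) ^+ (2 * n) * ('X - 2%:P) ^+ (8 * n - 2 * 1) :> {poly algC}.
  by rewrite -!exprD; congr (_ ^+ _); lia.
have rearrange (p q r s t u v w : {poly algC}) : v * w = p * u ->
    p * q * r * (s * t * u) = v * (t * s * (w * (q * r))).
  move=> vw; transitivity (v * w * (q * r * s * t)); last by ring.
  by rewrite vw; ring.
exact: rearrange.
Qed.

Lemma T8n_graph_spec : perm_eq (graph_spec (cay S))
  ([:: - (4 * n)%:R + 2; (4 * n + 2)%:R]
     ++ nseq (2 * n - 2) 2 ++ nseq (2 * n) (- 2) ++ nseq (4 * n) 0).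
Proof. by apply: prod_XsubC_eq; rewrite prod_graph_spec T8n_char_poly. Qed.

Lemma T8n_integral : integral_graph (cay S).
Proof.
move=> z; rewrite eigenvalue_root_char T8n_char_poly root_prod_XsubC.
rewrite !mem_cat !inE !mem_nseq -!orbA.
case/or4P=> [/eqP->|/eqP->|/andP[_ /eqP->]|/orP[]/andP[_ /eqP->]].
- by rewrite rpredD ?rpredN ?rpred_nat.
- by rewrite rpred_nat.
- by rewrite rpred_nat.
- by rewrite rpredN rpred_nat.
- by rewrite rpred0.
Qed.

End T8nCayley.

Theorem corollary5p2 (n : nat) (hn : (0 < n)%N) (gT : finGroupType)
    (a b : gT) (hT : is_T8n n a b) (S : {set gT})
    (hS : S = T8n_S1 n a b :|: T8n_S2 a b) :
  [/\ connection_set S,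
      normal_cay S,
      connected_graph (cay S),
      integral_graph (cay S)
    & perm_eq (graph_spec (cay S))
        ([:: - (4 * n)%:R + 2; (4 * n + 2)%:R]
           ++ nseq (2 * n - 2) 2 ++ nseq (2 * n) (- 2)
           ++ nseq (4 * n) 0)].
Proof.
rewrite hS; split.
- exact: T8n_connection_set.
- exact: T8n_normal_cay.
- exact: T8n_connected.
- exact: T8n_integral.
- exact: T8n_graph_spec.
Qed.
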